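(* Let $(\mathcal{G},\bullet,\{\mathbf 1_\lambda\}_{\lambda\in\Lambda})$ be a connected groupoid over a nonempty set $\Lambda$, with a braiding $\sigma(x\otimes y)=(x\rightharpoonup y)\otimes(x\leftharpoonup y)$, and let $\{\cdot_\lambda\}_{\lambda\in\Lambda}$ be the group operations of the corresponding skew bracoid. Let $\mathcal{G}'\subseteq\mathcal{G}$ be a maximal element (with respect to inclusion) among the subgroupoids of $\mathcal{G}$ that contain all units $\mathbf 1_\lambda$ ($\lambda\in\Lambda$) and have at most one arrow $\lambda\to\mu$ for all $\lambda,\mu\in\Lambda$ (it is known that such a $\mathcal{G}'$ exists, and that it has exactly one arrow $\lambda\to\mu$ for every $\lambda,\mu\in\Lambda$). Fix a vertex $\zeta\in\Lambda$, a set $A$ and a bijection $\varphi_\zeta\colon\mathcal{G}(\zeta,\Lambda)\to A$. For $\lambda\in\Lambda$ let $x_\lambda$ be the unique arrow of $\mathcal{G}'$ from $\zeta$ to $\lambda$, and let $\varphi_\lambda\colon\mathcal{G}(\lambda,\Lambda)\to A$ be the unique bijection such that $\varphi_\lambda(x_\lambda^{-\bullet}\rightharpoonup u)=\varphi_\zeta(u)$ for all $u\in\mathcal{G}(\zeta,\Lambda)$. Then $\{\varphi_\lambda\}_{\lambda\in\Lambda}$ is a Matsumoto--Shimizu labelling on $\mathcal{G}$, that is, the binary operation on $A$ $$(a,b)\mapsto \varphi_\lambda\big(\varphi_\lambda^{-1}(a)\cdot_\lambda\varphi_\lambda^{-1}(b)\big)$$ does not depend on $\lambda\in\Lambda$.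 Therefore every connected braided groupoid over $\Lambda$ is isomorphic over $\Lambda$, as a braided groupoid (equivalently, as a skew bracoid), to the one associated with some zero-symmetric dynamical skew brace over $\Lambda$.
   Context: A quiver over $\Lambda$ is a nonempty set $Q$ of arrows with source and target maps $\mathfrak s,\mathfrak t\colon Q\to\Lambda$; $Q(\lambda,\mu)$ is the set of arrows from $\lambda$ to $\mu$, and $Q(\lambda,\Lambda)$ the set of arrows with source $\lambda$. $Q\otimes Q$ is the quiver of pairs $x\otimes y=(x,y)$ with $\mathfrak t(x)=\mathfrak s(y)$, with source $\mathfrak s(x)$ and target $\mathfrak t(y)$. Morphisms over $\Lambda$ preserve sources and targets. Groupoid: a quiver $\mathcal G$ over $\Lambda$ with an associative product $x\otimes y\mapsto x\bullet y$ (a morphism $\mathcal G\otimes\mathcal G\to\mathcal G$ over $\Lambda$), two-sided units $\mathbf 1_\lambda$ and inverses $x^{-\bullet}$. It is connected if any two vertices are joined by an arrow. Braiding on a groupoid $\mathcal G$: a bijective morphism $\sigma\colon\mathcal G\otimes\mathcal G\to\mathcal G\otimes\mathcal G$ over $\Lambda$, $\sigma(x\otimes y)=(x\rightharpoonup y)\otimes(x\leftharpoonup y)$, such that, whenever defined, $\sigma(x\otimes\mathbf 1_{\mathfrak t(x)})=\mathbf 1_{\mathfrak s(x)}\otimes x$; $\sigma(\mathbf 1_{\mathfrak s(x)}\otimes x)=x\otimes\mathbf 1_{\mathfrak t(x)}$; $x\rightharpoonup(y\bullet z)=(x\rightharpoonup y)\bullet((x\leftharpoonup y)\rightharpoonup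 z)$; $x\leftharpoonup(y\bullet z)=(x\leftharpoonup y)\leftharpoonup z$; $(x\bullet y)\leftharpoonup z=(x\leftharpoonup(y\rightharpoonup z))\bullet(y\leftharpoonup z)$; $(x\bullet y)\rightharpoonup z=x\rightharpoonup(y\rightharpoonup z)$; $(x\rightharpoonup y)\bullet(x\leftharpoonup y)=x\bullet y$. A groupoid with a braiding is a braided groupoid; morphisms are groupoid morphisms $f$ such that $f\otimes f$ intertwines the braidings. Skew bracoid over $\Lambda$: a groupoid $(\mathcal G,\bullet)$ over $\Lambda$ with a group operation $\cdot_\lambda$ on each $\mathcal G(\lambda,\Lambda)$ such that $x\bullet(y\cdot_{\mathfrak t(x)}z)=(x\bullet y)\cdot_{\mathfrak s(x)}x^{-1}\cdot_{\mathfrak s(x)}(x\bullet z)$ whenever $\mathfrak t(x)=\mathfrak s(y)=\mathfrak s(z)$, where $x^{-1}$ is the inverse of $x$ in $(\mathcal G(\mathfrak s(x),\Lambda),\cdot_{\mathfrak s(x)})$. It is known that, for a fixed groupoid, braidings and skew bracoid structures correspond bijectively: from the braiding, $x\cdot_\lambda y=x\bullet(x^{-\bullet}\rightharpoonup y)$ for $x,y\in\mathcal G(\lambda,\Lambda)$; from the skew bracoid, $x\rightharpoonup y=x^{-1}\cdot_{\mathfrak s(x)}(x\bullet y)$ and $x\leftharpoonup y=(x\rightharpoonup y)^{-\bullet}\bullet x\bullet y$. Dynamical skew brace over $\Lambda$: a group $(A,\cdot)$, a map $\phi\colon\Lambda\times A\to\Lambda$, and binary operations $\bullet_\lambda$ ($\lambda\in\Lambda$)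 on $A$ with $a\bullet_\lambda(\,\cdot\,)$ bijective for all $a,\lambda$, such that $a\bullet_\lambda(b\bullet_{\phi(\lambda,a)}c)=(a\bullet_\lambda b)\bullet_\lambda c$ and $a\bullet_\lambda(b\cdot c)=(a\bullet_\lambda b)\cdot a^{-1}\cdot(a\bullet_\lambda c)$; moreover $\phi(\lambda,a\bullet_\lambda b)=\phi(\phi(\lambda,a),b)$, and $\phi(\lambda,1_A)=\lambda$ whenever $1_A\bullet_\lambda b=b$ for all $b\in A$. It is zero-symmetric if $1_A\bullet_\lambda b=b$ for all $\lambda\in\Lambda,b\in A$. The skew bracoid associated with a zero-symmetric dynamical skew brace has arrows $[\lambda\Vert a]$ ($(\lambda,a)\in\Lambda\times A$), $\mathfrak s([\lambda\Vert a])=\lambda$, $\mathfrak t([\lambda\Vert a])=\phi(\lambda,a)$, $[\lambda\Vert a]\bullet[\phi(\lambda,a)\Vert b]=[\lambda\Vert a\bullet_\lambda b]$, $\mathbf 1_\lambda=[\lambda\Vert 1_A]$, $[\lambda\Vert a]\cdot_\lambda[\lambda\Vert b]=[\lambda\Vert a\cdot b]$. *)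

(* Defs.v *)
From HB Require Import structures.
From mathcomp Require Import all_boot.
From mathcomp Require Import boolp classical_sets functions.

Set Implicit Arguments.
Unset Strict Implicit.
Unset Printing Implicit Defensive.

Local Open Scope classical_set_scope.

(* Partial operations are total functions whose axioms are only required, and
   whose values only matter, on their domain: composable pairs for the product
   of a groupoid and for a braiding, pairs of arrows with source l for the l-th
   group operation of a skew bracoid. *)

Record quiver (L : Type) := Quiver {
  arrow :> Type;
  src : arrow -> L;
  tgt : arrow -> L;
  quiver_nonempty : inhabited arrow
}.

Definition arrows_from (L : Type) (Q : quiver L) (l : L) : set Q :=
  [set x | src x = l].
Arguments arrows_from {L} Q l.

(* The underlying set of Q (x) Q. *)
Definition composable (L : Type) (Q : quiver L) : set (Q * Q) :=
  [set p | tgt p.1 = src p.2].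
Arguments composable {L} Q.

(* x \bu y is "first x, then y". *)
Reserved Notation "x \bu y" (at level 40, left associativity).

Record groupoid (L : Type) := Groupoid {
  gquiver :> quiver L;
  gmul : gquiver -> gquiver -> gquiver;
  gunit : L -> gquiver;
  ginv : gquiver -> gquiver;
  src_gmul : forall x y, tgt x = src y -> src (gmul x y) = src x;
  tgt_gmul : forall x y, tgt x = src y -> tgt (gmul x y) = tgt y;
  src_gunit : forall l, src (gunit l) = l;
  tgt_gunit : forall l, tgt (gunit l) = l;
  src_ginv : forall x, src (ginv x) = tgt x;
  tgt_ginv : forall x, tgt (ginv x) = src x;
  gmulA : forall x y z, tgt x = src y -> tgt y = src z ->
    gmul x (gmul y z) = gmul (gmul x y) z;
  gmul1x : forall x, gmul (gunit (src x)) x = x;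
  gmulx1 : forall x, gmul x (gunit (tgt x)) = x;
  gmulVx : forall x, gmul (ginv x) x = gunit (tgt x);
  gmulxV : forall x, gmul x (ginv x) = gunit (src x)
}.

Notation "x \bu y" := (gmul x y).

Definition connected (L : Type) (G : groupoid L) : Prop :=
  forall l m : L, exists x : G, src x = l /\ tgt x = m.

Definition subgroupoid (L : Type) (G : groupoid L) (S : set G) : Prop :=
  (forall x y, S x -> S y -> tgt x = src y -> S (x \bu y)) /\
  (forall x, S x -> S (ginv x)).

Definition wide_thin_subgroupoid (L : Type) (G : groupoid L) (S : set G) :
    Prop :=
  [/\ subgroupoid S,
      forall l, S (gunit G l) &
      forall x y, S x -> S y -> src x = src y -> tgt x = tgt y -> x = y].

Definition maximal_wide_thin (L : Type) (G : groupoid L) (S : set G) : Prop :=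
  wide_thin_subgroupoid S /\
  forall T : set G, wide_thin_subgroupoid T -> S `<=` T -> T = S.

Definition groupoid_morphism (L : Type) (G H : groupoid L) (f : G -> H) :
    Prop :=
  [/\ forall x, src (f x) = src x,
      forall x, tgt (f x) = tgt x,
      forall l, f (gunit G l) = gunit H l &
      forall x y, tgt x = src y -> f (x \bu y) = f x \bu f y].

(* lact x y is x \rightharpoonup y and ract x y is x \leftharpoonup y. *)
Definition braid_map (T : Type) (lact ract : T -> T -> T) (p : T * T) : T * T :=
  (lact p.1 p.2, ract p.1 p.2).

(* That the braiding sends composable pairs to composable pairs is part of
   braid_bij. *)
Record braiding (L : Type) (G : groupoid L) := Braiding {
  lact : G -> G -> G;
  ract : G -> G -> G;
  braid_bij : set_bij (composable G) (composable G) (braid_map lact ract);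
  src_lact : forall x y, tgt x = src y -> src (lact x y) = src x;
  tgt_ract : forall x y, tgt x = src y -> tgt (ract x y) = tgt y;
  lactx1 : forall x, lact x (gunit G (tgt x)) = gunit G (src x);
  ractx1 : forall x, ract x (gunit G (tgt x)) = x;
  lact1x : forall x, lact (gunit G (src x)) x = x;
  ract1x : forall x, ract (gunit G (src x)) x = gunit G (tgt x);
  lactM : forall x y z, tgt x = src y -> tgt y = src z ->
    lact x (y \bu z) = lact x y \bu lact (ract x y) z;
  ractM : forall x y z, tgt x = src y -> tgt y = src z ->
    ract x (y \bu z) = ract (ract x y) z;
  Mract : forall x y z, tgt x = src y -> tgt y = src z ->
    ract (x \bu y) z = ract x (lact y z) \bu ract y z;
  Mlact : forall x y z, tgt x = src y -> tgt y = src z ->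
    lact (x \bu y) z = lact x (lact y z);
  braid_comm : forall x y, tgt x = src y -> lact x y \bu ract x y = x \bu y
}.

Definition braided_morphism (L : Type) (G H : groupoid L) (s : braiding G)
    (t : braiding H) (f : G -> H) : Prop :=
  groupoid_morphism f /\
  forall x y, tgt x = src y ->
    f (lact s x y) = lact t (f x) (f y) /\ f (ract s x y) = ract t (f x) (f y).

Definition braided_isomorphism (L : Type) (G H : groupoid L) (s : braiding G)
    (t : braiding H) (f : G -> H) : Prop :=
  braided_morphism s t f /\
  exists g : H -> G, [/\ braided_morphism t s g, cancel f g & cancel g f].

Record group_on (T : Type) (D : set T) (op : T -> T -> T) (e : T)
    (inv : T -> T) : Prop := GroupOn {
  grp_op : forall x y, D x -> D y -> D (op x y);
  grp_e : D e;
  grp_inv : forall x, D x -> D (inv x);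
  grpA : forall x y z, D x -> D y -> D z -> op x (op y z) = op (op x y) z;
  grp1x : forall x, D x -> op e x = x;
  grpx1 : forall x, D x -> op x e = x;
  grpVx : forall x, D x -> op (inv x) x = e;
  grpxV : forall x, D x -> op x (inv x) = e
}.

Record skew_bracoid (L : Type) (G : groupoid L) := SkewBracoid {
  sdot : L -> G -> G -> G;
  sone : L -> G;
  sinv : L -> G -> G;
  sdot_group : forall l,
    group_on (arrows_from G l) (sdot l) (sone l) (sinv l);
  gmul_sdot : forall x y z, tgt x = src y -> tgt x = src z ->
    x \bu sdot (tgt x) y z =
    sdot (src x) (sdot (src x) (x \bu y) (sinv (src x) x)) (x \bu z)
}.

Definition bracoid_morphism (L : Type) (G H : groupoid L) (B : skew_bracoid G)
    (C : skew_bracoid H) (f : G -> H) : Prop :=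
  groupoid_morphism f /\
  forall l x y, src x = l -> src y = l ->
    f (sdot B l x y) = sdot C l (f x) (f y).

Definition bracoid_isomorphism (L : Type) (G H : groupoid L)
    (B : skew_bracoid G) (C : skew_bracoid H) (f : G -> H) : Prop :=
  bracoid_morphism B C f /\
  exists g : H -> G, [/\ bracoid_morphism C B g, cancel f g & cancel g f].

Section GroupOnTheory.
Variables (T : Type) (D : set T) (op : T -> T -> T) (e : T) (inv : T -> T).
Hypothesis gD : group_on D op e inv.

Lemma grp_mulKV x y : D x -> D y -> op x (op (inv x) y) = y.
Proof.
by move=> Dx Dy; rewrite (grpA gD) ?(grpxV gD) ?(grp1x gD) //; exact: grp_inv gD _ _.
Qed.

Lemma grp_mulK x y : D x -> D y -> op (inv x) (op x y) = y.
Proof.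
by move=> Dx Dy; rewrite (grpA gD) ?(grpVx gD) ?(grp1x gD) //; exact: grp_inv gD _ _.
Qed.

Lemma grp_mulVK x y : D x -> D y -> op (op y (inv x)) x = y.
Proof.
move=> Dx Dy; rewrite -(grpA gD) ?(grpVx gD) ?(grpx1 gD) //.
exact: grp_inv gD _ _.
Qed.

Lemma grp_mulxK x y : D x -> D y -> op (op y x) (inv x) = y.
Proof.
move=> Dx Dy; rewrite -(grpA gD) ?(grpxV gD) ?(grpx1 gD) //.
exact: grp_inv gD _ _.
Qed.

Lemma grp_mulI x y z : D x -> D y -> D z -> op x y = op x z -> y = z.
Proof. by move=> Dx Dy Dz E; rewrite -(grp_mulK Dx Dy) E grp_mulK. Qed.

End GroupOnTheory.

Section GroupoidTheory.
Variables (L : Type) (G : groupoid L).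
Implicit Types x y z : G.


Lemma gmulK x y : tgt x = src y -> ginv x \bu (x \bu y) = y.
Proof. by move=> h; rewrite gmulA ?tgt_ginv // gmulVx h gmul1x. Qed.

Lemma gmulVK x y : src x = src y -> x \bu (ginv x \bu y) = y.
Proof.
by move=> h; rewrite gmulA ?tgt_ginv ?src_ginv // gmulxV h gmul1x.
Qed.

Lemma gmulxVK x y : tgt x = src y -> (x \bu y) \bu ginv y = x.
Proof. by move=> h; rewrite -gmulA ?src_ginv // gmulxV -h gmulx1. Qed.

Lemma gmul_inj x y z : tgt x = src y -> tgt x = src z -> x \bu y = x \bu z -> y = z.
Proof. by move=> hy hz E; rewrite -(gmulK hy) E gmulK. Qed.

Lemma ginv_uniq x y : tgt x = src y -> x \bu y = gunit G (src x) -> y = ginv x.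
Proof. by move=> h E; apply: (@gmul_inj x); rewrite ?src_ginv // gmulxV. Qed.

Lemma ginvK x : ginv (ginv x) = x.
Proof. by symmetry; apply: ginv_uniq; rewrite ?tgt_ginv // gmulVx src_ginv. Qed.

Lemma ginv1 l : ginv (gunit G l) = gunit G l.
Proof.
symmetry; apply: ginv_uniq; rewrite ?tgt_gunit ?src_gunit //.
by have := gmulx1 (gunit G l); rewrite tgt_gunit.
Qed.

Lemma ginvM x y : tgt x = src y -> ginv (x \bu y) = ginv y \bu ginv x.
Proof.
move=> h; symmetry; apply: ginv_uniq.
  by rewrite tgt_gmul // src_gmul ?src_ginv ?tgt_ginv.
by rewrite gmulA ?tgt_gmul ?src_ginv ?tgt_ginv // gmulxVK // gmulxV src_gmul.
Qed.

End GroupoidTheory.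

(* Rewrites sources and targets of compound arrows, then closes the goal. *)
Ltac ends := solve [ repeat first
  [ done | rewrite src_gunit | rewrite tgt_gunit | rewrite src_ginv
  | rewrite tgt_ginv
  | rewrite src_gmul; [ | ends ] | rewrite tgt_gmul; [ | ends ]
  | congruence ] ].

Section BracoidOfBraiding.
Variables (L : Type) (G : groupoid L) (s : braiding G).
Implicit Types x y z : G.

Lemma tgt_lact x y : tgt x = src y -> tgt (lact s x y) = src (ract s x y).
Proof. by case: (braid_bij s) => h _ _ xy; apply: (h (x, y)). Qed.

Lemma lactK x y : tgt x = src y -> lact s (ginv x) (lact s x y) = y.
Proof. by move=> h; rewrite -Mlact ?tgt_ginv // gmulVx h lact1x. Qed.

Lemma lactVK x y : src x = src y -> lact s x (lact s (ginv x) y) = y.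
Proof. by move=> h; rewrite -{1}(ginvK x) lactK // tgt_ginv. Qed.

Definition bdot (l : L) x y := x \bu lact s (ginv x) y.
Definition bone (l : L) := gunit G l.
Definition bdinv (l : L) x := lact s x (ginv x).

Lemma src_lactV x y : src x = src y -> src (lact s (ginv x) y) = tgt x.
Proof. by move=> h; rewrite src_lact ?tgt_ginv // src_ginv. Qed.

Lemma src_bdot l x y : src x = src y -> src (bdot l x y) = src x.
Proof. by move=> h; rewrite src_gmul // src_lactV. Qed.

Lemma bdotA l x y z : src x = src y -> src y = src z ->
  bdot l x (bdot l y z) = bdot l (bdot l x y) z.
Proof.
move=> xy yz; rewrite /bdot.
have tV : tgt (ginv x) = src y by ends.
have yV := src_lactV yz.
have xV := src_lactV xy.
rewrite lactM // gmulA ?src_lact ?tgt_ginv ?src_ginv ?tgt_lact //; last first.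
  by rewrite tgt_ract.
congr (_ \bu _).
rewrite -Mlact ?tgt_ract ?src_ginv ?tgt_ginv //.
congr lact.
rewrite ginvM ?xV //.
have E := braid_comm s tV.
have F : ract s (ginv x) y = ginv (lact s (ginv x) y) \bu (ginv x \bu y).
  by rewrite -E gmulK // tgt_lact.
rewrite F -gmulA; [|ends|by rewrite src_ginv tgt_gmul].
by rewrite gmulxVK.
Qed.

Lemma bdot_group l : group_on (arrows_from G l) (bdot l) (bone l) (bdinv l).
Proof.
have d1 x : src x = l -> bdot l (bone l) x = x.
  move=> <-; rewrite /bdot /bone ginv1 lact1x gmul1x //.
have dV x : src x = l -> bdot l x (bdinv l x) = bone l.
  move=> xl; rewrite /bdot /bdinv lactK ?src_ginv //.
  by rewrite gmulxV xl.
have dx x : src x = l -> bdot l x (bone l) = x.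
  move=> <-; rewrite /bdot /bone -(tgt_ginv x) lactx1 src_ginv.
  by rewrite gmulx1.
have sV x : src x = l -> src (bdinv l x) = l.
  by move=> xl; rewrite /bdinv src_lact ?src_ginv.
rewrite /arrows_from; split=> //=.
- by move=> x y /= xl yl; rewrite src_bdot // xl yl.
- by rewrite /= src_gunit.
- by move=> x y z /= xl yl zl; rewrite bdotA // ?xl ?yl ?zl.
move=> x /= xl.
have a1 := sV _ xl; have a2 := sV _ a1.
have E : bdinv l (bdinv l x) = x.
  rewrite -[RHS]dx // -(dV (bdinv l x)) // bdotA ?a1 ?a2 ?xl //.
  by rewrite dV // d1.
by rewrite -{2}E dV.
Qed.

Lemma gmul_bdot x y z : tgt x = src y -> tgt x = src z ->
  x \bu bdot (tgt x) y z =
  bdot (src x) (bdot (src x) (x \bu y) (bdinv (src x) x)) (x \bu z).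
Proof.
move=> xy xz; have yz : src y = src z by rewrite -xy.
have E : bdot (src x) (bdinv (src x) x) (x \bu z) = lact s x z.
  have gD := bdot_group (src x).
  have D1 : src (lact s x z) = src x by rewrite src_lact.
  rewrite -[RHS](grp_mulK gD (x := x)) //; congr bdot.
  by rewrite /bdot lactK.
have sV : src (bdinv (src x) x) = src x by rewrite src_lact // src_ginv.
rewrite -bdotA ?E; [|by rewrite sV src_gmul|by rewrite sV src_gmul].
rewrite /bdot ginvM // Mlact ?tgt_ginv ?src_ginv // ?src_lact //.
rewrite lactK // gmulA //.
by rewrite src_lactV.
Qed.

Definition bracoid_of_braiding : skew_bracoid G :=
  SkewBracoid bdot_group gmul_bdot.

End BracoidOfBraiding.

Section BraidingOfBracoid.
Variables (L : Type) (G : groupoid L) (B : skew_bracoid G).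
Implicit Types x y z : G.

Let D l := arrows_from G l.
Let gD l := sdot_group B l.

Lemma sdot_src l x y : src x = l -> src y = l -> src (sdot B l x y) = l.
Proof. exact: (grp_op (gD l)). Qed.

Lemma sinv_src l x : src x = l -> src (sinv B l x) = l.
Proof. exact: (grp_inv (gD l)). Qed.

Definition slact x y := sdot B (src x) (sinv B (src x) x) (x \bu y).
Definition sract x y := ginv (slact x y) \bu (x \bu y).

Lemma src_slact x y : tgt x = src y -> src (slact x y) = src x.
Proof.
by move=> h; rewrite sdot_src ?sinv_src // src_gmul.
Qed.

Lemma sdot_slact x y : tgt x = src y -> sdot B (src x) x (slact x y) = x \bu y.
Proof. by move=> h; rewrite (grp_mulKV (gD _)) //; exact: src_gmul. Qed.

Lemma sone_unit l : sone B l = gunit G l.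
Proof.
have se m : src (sone B m) = m := grp_e (gD m).
set e := sone B l; have el : src e = l by exact: se.
have tx : tgt (gunit G l) = src e by rewrite tgt_gunit el.
have := gmul_sdot B tx tx.
rewrite tgt_gunit src_gunit (grp1x (gD l)) //.
have -> : gunit G l \bu e = e by rewrite -{1}el gmul1x.
have s1 : src (gunit G l) = l by rewrite src_gunit.
rewrite (grpx1 (gD l)); last by apply: sdot_src => //; apply: sinv_src.
rewrite (grp1x (gD l)); last exact: sinv_src.
move=> E; rewrite -[RHS](grpx1 (gD l)) // -/e [X in sdot _ _ _ X]E.
by rewrite (grpxV (gD l)).
Qed.

Lemma slactD x y z : tgt x = src y -> tgt x = src z ->
  slact x (sdot B (tgt x) y z) = sdot B (src x) (slact x y) (slact x z).
Proof.
move=> xy xz; rewrite /slact gmul_sdot //.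
have a : src (sinv B (src x) x) = src x by apply: sinv_src.
have b : src (x \bu y) = src x by rewrite src_gmul.
have c : src (x \bu z) = src x by rewrite src_gmul.
rewrite !(grpA (gD _)) //=; exact: sdot_src.
Qed.

Lemma slactx1 x : slact x (gunit G (tgt x)) = gunit G (src x).
Proof. by rewrite /slact gmulx1 (grpVx (gD _)) // sone_unit. Qed.

Lemma slactV x y : tgt x = src y ->
  slact x (sinv B (tgt x) y) = sinv B (src x) (slact x y).
Proof.
move=> h; have a : src (sinv B (tgt x) y) = tgt x by exact: sinv_src.
have b := src_slact h.
have c : src (slact x (sinv B (tgt x) y)) = src x by rewrite src_slact.
apply: (grp_mulI (gD (src x)) (x := slact x y)) => //; first exact: sinv_src.
by rewrite -slactD // (grpxV (gD _)) // (grpxV (gD _)) // !sone_unit slactx1.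
Qed.

Lemma slact1x x : slact (gunit G (src x)) x = x.
Proof.
rewrite /slact gmul1x src_gunit -[in sinv _ _ _]sone_unit.
rewrite -[X in sdot _ _ _ X = _](grp1x (gD (src x))) //.
by rewrite (grp_mulK (gD _)) //; apply: (grp_e (gD _)).
Qed.

Lemma Mslact x y z : tgt x = src y -> tgt y = src z ->
  slact (x \bu y) z = slact x (slact y z).
Proof.
move=> xy yz.
have a : src (sinv B (src y) y) = src y by exact: sinv_src.
have b : src (y \bu z) = src y by rewrite src_gmul.
have c : src (x \bu y) = src x by rewrite src_gmul.
have d : src (x \bu (y \bu z)) = src x by rewrite src_gmul // b.
have yzE : slact y z = sdot B (tgt x) (sinv B (tgt x) y) (y \bu z).
  by rewrite xy.
have yi : src (sinv B (tgt x) y) = tgt x by exact: sinv_src.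
rewrite yzE slactD ?yi ?b // slactV // /slact gmulA // c.
set l := src x in c d *; set v := x \bu y in c *; set w := v \bu z.
have ws : src w = l by rewrite /w -gmulA.
set u := sinv B l x.
have us : src u = l by exact: sinv_src.
have uvs : src (sdot B l u v) = l by exact: sdot_src.
have uvi : src (sinv B l (sdot B l u v)) = l by exact: sinv_src.
have vi : src (sinv B l v) = l by exact: sinv_src.
rewrite (grpA (gD _)) //; congr (sdot B _ _ w).
apply: (grp_mulI (gD l) (x := sdot B l u v)) => //=; first exact: sdot_src.
rewrite (grp_mulxK (gD l)) //.
by rewrite (grp_mulKV (gD l)).
Qed.

Lemma src_sract x y : tgt x = src y -> src (sract x y) = tgt (slact x y).
Proof.
by move=> h; rewrite src_gmul ?src_ginv ?tgt_ginv // src_slact // src_gmul.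
Qed.

Lemma tgt_sract x y : tgt x = src y -> tgt (sract x y) = tgt y.
Proof.
move=> h; rewrite tgt_gmul ?tgt_gmul ?tgt_ginv //.
by rewrite src_slact // src_gmul.
Qed.

Lemma sbraid_comm x y : tgt x = src y -> slact x y \bu sract x y = x \bu y.
Proof.
move=> h; rewrite /sract gmulVK // src_slact // src_gmul //.
Qed.

Lemma sractx1 x : sract x (gunit G (tgt x)) = x.
Proof. by rewrite /sract slactx1 gmulx1 ginv1 gmul1x. Qed.

Lemma sract1x x : sract (gunit G (src x)) x = gunit G (tgt x).
Proof. by rewrite /sract slact1x gmul1x gmulVx. Qed.

Lemma gmul_sdotE l m x y z : src x = l -> tgt x = m -> src y = m -> src z = m ->
  x \bu sdot B m y z = sdot B l (sdot B l (x \bu y) (sinv B l x)) (x \bu z).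
Proof. by move=> <- <- yx zx; rewrite gmul_sdot. Qed.

Lemma slactM x y z : tgt x = src y -> tgt y = src z ->
  slact x (y \bu z) = slact x y \bu slact (sract x y) z.
Proof.
move=> xy yz.
have E := sbraid_comm xy; have uv := src_sract xy; have vz := tgt_sract xy.
have us := src_slact xy.
have uE : slact x y = sdot B (src x) (sinv B (src x) x) (x \bu y) by [].
set u := slact x y in E uv us uE *; set v := sract x y in E uv vz *.
have ->  : slact v z = sdot B (tgt u) (sinv B (tgt u) v) (v \bu z).
  by rewrite -uv.
have -> : slact x (y \bu z) =
    sdot B (src x) (sinv B (src x) x) (x \bu y \bu z).
  by rewrite /slact gmulA.
set l := src x in us uE *; set w := x \bu y in E uE *.
have ws : src w = l by rewrite src_gmul.
have vzc : tgt v = src z by rewrite vz.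
have vzs : src (v \bu z) = tgt u by rewrite src_gmul.
have vi : src (sinv B (tgt u) v) = tgt u by exact: sinv_src.
have ui : src (sinv B l u) = l by exact: sinv_src.
have xi : src (sinv B l x) = l by exact: sinv_src.
have wi : src (sinv B l w) = l by exact: sinv_src.
have wzs : src (w \bu z) = l by rewrite src_gmul // tgt_gmul.
rewrite (gmul_sdotE us) // gmulA // E.
have E1 : u \bu sinv B (tgt u) v = sdot B l u (sdot B l (sinv B l w) u).
  have h : tgt u = src (sinv B (tgt u) v) by rewrite vi.
  have := sdot_slact h; rewrite us => <-; congr (sdot B _ _ _).
  rewrite slactV // us.
  have h2 : src (slact u v) = l by rewrite src_slact.
  have E2 : sdot B l u (slact u v) = w by rewrite -us sdot_slact.
  have h3 : src (sinv B l (slact u v)) = l by exact: sinv_src.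
  apply: (grp_mulI (gD l) (x := w)) => //=; first exact: sdot_src.
  by rewrite (grp_mulKV (gD _)) // -E2 (grp_mulxK (gD _)).
have h4 : src (sdot B l (sinv B l w) u) = l by exact: sdot_src.
rewrite E1 (grpA (gD l)) // (grp_mulxK (gD l)) //; last exact: sdot_src.
by rewrite uE (grp_mulxK (gD l)).
Qed.

Lemma sractM x y z : tgt x = src y -> tgt y = src z ->
  sract x (y \bu z) = sract (sract x y) z.
Proof.
move=> xy yz.
have vz : tgt (sract x y) = src z by rewrite tgt_sract.
have uv := src_sract xy; have vs := src_slact vz; have us := src_slact xy.
have ws : src (x \bu y) = src x by rewrite src_gmul.
have wt : tgt (x \bu y) = src z by rewrite tgt_gmul.
have E : x \bu (y \bu z) = slact x y \bu (sract x y \bu z).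
  by rewrite gmulA // -(sbraid_comm xy) -gmulA ?uv ?vz.
have ut : tgt (slact x y) = src (slact (sract x y) z) by rewrite vs uv.
have uvz : tgt (slact x y) = src (sract x y \bu z) by rewrite src_gmul.
rewrite [LHS]/sract slactM // ginvM // E -gmulA; last 2 first.
- by rewrite src_ginv tgt_ginv ut.
- by rewrite tgt_ginv src_gmul.
by rewrite gmulK.
Qed.

Lemma Msract x y z : tgt x = src y -> tgt y = src z ->
  sract (x \bu y) z = sract x (slact y z) \bu sract y z.
Proof.
move=> xy yz.
have a := src_slact yz; have xv : tgt x = src (slact y z) by rewrite a.
have ts := tgt_sract xv; have ss := src_sract yz; have b := src_slact xv.
have c : src (x \bu slact y z) = src x by rewrite src_gmul.
rewrite [LHS]/sract Mslact // [sract x _]/sract -[_ \bu z]gmulA //.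
rewrite -[RHS]gmulA; last 2 first.
- by rewrite tgt_ginv b c.
- by rewrite tgt_gmul.
by rewrite -gmulA ?sbraid_comm.
Qed.

Lemma sbraid_bij :
  set_bij (composable G) (composable G) (braid_map slact sract).
Proof.
have H x y : tgt x = src y ->
    x = sdot B (src (slact x y)) (slact x y \bu sract x y)
          (sinv B (src (slact x y)) (slact x y)).
  move=> h; rewrite sbraid_comm // src_slact //.
  have := src_slact h; set u := slact x y => us.
  by rewrite -sdot_slact // -/u (grp_mulxK (gD _)).
have K x y : tgt x = src y -> y = ginv x \bu (slact x y \bu sract x y).
  by move=> h; rewrite sbraid_comm // gmulK.
split=> [[x y] /= h|[x y] [x' y'] /set_mem /= h /set_mem /= h' [E F]|[u v] /= h].
- by rewrite /composable /= src_sract.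
- have E1 : x = x' by rewrite (H x y) // (H x' y') // E F.
  by rewrite (K x y) // (K x' y') // E F -E1.
have ws : src (u \bu v) = src u by rewrite src_gmul.
pose x := sdot B (src u) (u \bu v) (sinv B (src u) u).
have ui : src (sinv B (src u) u) = src u by exact: sinv_src.
have xs : src x = src u by exact: sdot_src.
pose y := ginv x \bu (u \bu v).
have xy : tgt x = src y by rewrite src_gmul ?src_ginv ?tgt_ginv // xs ws.
have E : x \bu y = u \bu v by rewrite gmulVK // xs ws.
have U : slact x y = u.
  rewrite /slact E xs; apply: (grp_mulI (gD (src u)) (x := x)) => //=.
    by apply: sdot_src => //; exact: sinv_src.
  by rewrite (grp_mulKV (gD _)) //= /x (grp_mulVK (gD _)).
exists (x, y) => //; rewrite /braid_map /= /sract U E.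
by rewrite gmulK.
Qed.

Definition braiding_of_bracoid : braiding G :=
  Braiding sbraid_bij src_slact tgt_sract slactx1 sractx1 slact1x sract1x
    slactM sractM Msract Mslact sbraid_comm.

End BraidingOfBracoid.

Record dyn_skew_brace (L : Type) (A : groupType) := DynSkewBrace {
  dphi : L -> A -> L;
  dmul : L -> A -> A -> A;
  dmul_bij : forall l a, bijective (dmul l a);
  dmulA : forall l a b c,
    dmul l a (dmul (dphi l a) b c) = dmul l (dmul l a b) c;
  dmulD : forall l a b c,
    dmul l a (b * c)%g = (dmul l a b * a^-1 * dmul l a c)%g;
  dphiM : forall l a b, dphi l (dmul l a b) = dphi (dphi l a) b;
  dphi1 : forall l, (forall b, dmul l 1%g b = b) -> dphi l 1%g = l
}.

Definition zero_symmetric (L : Type) (A : groupType)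
    (B : dyn_skew_brace L A) : Prop :=
  forall l b, dmul B l 1%g b = b.

Section BracoidOfDynSkewBrace.
Variables (L : Type) (A : groupType) (B : dyn_skew_brace L A).
Hypotheses (hL : inhabited L) (hB : zero_symmetric B).

Let LA_inhabited : inhabited (L * A).
Proof. by case: hL => l; constructor; exact: (l, 1%g). Qed.

(* The pair (l, a) is the arrow [l || a]. *)
Definition dsb_quiver : quiver L :=
  @Quiver L (L * A) fst (fun x => dphi B x.1 x.2) LA_inhabited.

Let dmul_inv_ex l a : exists b, dmul B l a b = 1%g.
Proof. by have [g _ gK] := dmul_bij B l a; exists (g 1%g). Qed.

Definition dsb_gmul (x y : dsb_quiver) : dsb_quiver :=
  (x.1, dmul B x.1 x.2 y.2).
Definition dsb_gunit (l : L) : dsb_quiver := (l, 1%g).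
Definition dsb_ginv (x : dsb_quiver) : dsb_quiver :=
  (dphi B x.1 x.2, projT1 (cid (dmul_inv_ex x.1 x.2))).

Let dmul_inv l a : dmul B l a (projT1 (cid (dmul_inv_ex l a))) = 1%g.
Proof. exact: projT2 (cid (dmul_inv_ex l a)). Qed.

Let dmul1 l a : dmul B l a 1%g = a.
Proof.
have := dmulD B l a 1%g 1%g.
rewrite mulg1 -mulgA -[LHS]mulg1 => /mulgI E.
by rewrite -(mulVKg a (dmul B l a 1%g)) -E mulg1.
Qed.

Fact dsb_src_gmul (x y : dsb_quiver) : tgt x = src y ->
  src (dsb_gmul x y) = src x.
Proof. by []. Qed.

Fact dsb_tgt_gmul (x y : dsb_quiver) : tgt x = src y ->
  tgt (dsb_gmul x y) = tgt y.
Proof. by move=> /= h; rewrite dphiM h. Qed.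

Fact dsb_src_gunit l : src (dsb_gunit l) = l.
Proof. by []. Qed.

Fact dsb_tgt_gunit l : tgt (dsb_gunit l) = l.
Proof. exact/dphi1/hB. Qed.

Fact dsb_src_ginv x : src (dsb_ginv x) = tgt x.
Proof. by []. Qed.

Fact dsb_tgt_ginv x : tgt (dsb_ginv x) = src x.
Proof. by rewrite /= -dphiM dmul_inv; exact/dphi1/hB. Qed.

Fact dsb_gmulA (x y z : dsb_quiver) : tgt x = src y -> tgt y = src z ->
  dsb_gmul x (dsb_gmul y z) = dsb_gmul (dsb_gmul x y) z.
Proof. by rewrite /dsb_gmul /= => <- _; rewrite dmulA. Qed.

Fact dsb_gmul1x x : dsb_gmul (dsb_gunit (src x)) x = x.
Proof. by case: x => l a; rewrite /dsb_gmul /= hB. Qed.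

Fact dsb_gmulx1 x : dsb_gmul x (dsb_gunit (tgt x)) = x.
Proof. by case: x => l a; rewrite /dsb_gmul /= dmul1. Qed.

Fact dsb_gmulxV x : dsb_gmul x (dsb_ginv x) = dsb_gunit (src x).
Proof. by rewrite /dsb_gmul dmul_inv. Qed.

Fact dsb_gmulVx x : dsb_gmul (dsb_ginv x) x = dsb_gunit (tgt x).
Proof.
congr (_, _); apply: (bij_inj (dmul_bij B x.1 x.2)) => /=.
by rewrite dmulA dmul_inv hB dmul1.
Qed.

Definition dsb_groupoid : groupoid L :=
  Groupoid dsb_src_gmul dsb_tgt_gmul dsb_src_gunit dsb_tgt_gunit dsb_src_ginv
    dsb_tgt_ginv dsb_gmulA dsb_gmul1x dsb_gmulx1 dsb_gmulVx dsb_gmulxV.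

Definition dsb_dot (l : L) (x y : dsb_groupoid) : dsb_groupoid :=
  (l, (x.2 * y.2)%g).
Definition dsb_one (l : L) : dsb_groupoid := (l, 1%g).
Definition dsb_inv (l : L) (x : dsb_groupoid) : dsb_groupoid :=
  (l, (x.2^-1)%g).

Fact dsb_dot_group l :
  group_on (arrows_from dsb_groupoid l) (dsb_dot l) (dsb_one l) (dsb_inv l).
Proof.
rewrite /arrows_from /dsb_dot /dsb_one /dsb_inv.
split=> //= [? ? ? _ _ _|[? ?] /= ->|[? ?] /= ->|? _|? _].
- by rewrite mulgA.
- by rewrite mul1g.
- by rewrite mulg1.
- by rewrite mulVg.
- by rewrite mulgV.
Qed.

Fact dsb_gmul_dot (x y z : dsb_groupoid) : tgt x = src y -> tgt x = src z ->
  x \bu dsb_dot (tgt x) y z =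
  dsb_dot (src x) (dsb_dot (src x) (x \bu y) (dsb_inv (src x) x)) (x \bu z).
Proof. by move=> _ _; congr (_, _); rewrite /= dmulD. Qed.

Definition dsb_bracoid : skew_bracoid dsb_groupoid :=
  SkewBracoid dsb_dot_group dsb_gmul_dot.

Definition dsb_braiding : braiding dsb_groupoid :=
  braiding_of_bracoid dsb_bracoid.

End BracoidOfDynSkewBrace.

(* A family of labellings is given by total maps phi l : G -> A, of which only
   the values on arrows_from G l matter. The operation below is
   (a, b) |-> phi_l (phi_l^-1 a ._l phi_l^-1 b). *)
Definition labelled_op (L : Type) (G : groupoid L) (B : skew_bracoid G)
    (A : Type) (phi : L -> G -> A) (l : L) (a b : A) : A :=
  let phiV := 'pinv_(fun=> gunit G l) (arrows_from G l) (phi l) in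
  phi l (sdot B l (phiV a) (phiV b)).

Definition Matsumoto_Shimizu_labelling (L : Type) (G : groupoid L)
    (B : skew_bracoid G) (A : Type) (phi : L -> G -> A) : Prop :=
  (forall l, set_bij (arrows_from G l) [set: A] (phi l)) /\
  forall l m, labelled_op B phi l =2 labelled_op B phi m.

(* xl is the arrow of the wide thin subgroupoid from zeta to l. *)
Definition transported_labelling (L : Type) (G : groupoid L) (s : braiding G)
    (A : Type) (zeta : L) (phi_zeta : G -> A) (xl : G) (l : L)
    (phi_l : G -> A) : Prop :=
  set_bij (arrows_from G l) [set: A] phi_l /\
  forall u, src u = zeta -> phi_l (lact s (ginv xl) u) = phi_zeta u.

(* Main.v *)
(* For tgt x = src y, lact x y = x^-1 . (x \bu y), so lact x is a group
   isomorphism from the fibre over tgt x to the fibre over src x; labellings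
   transported along lact therefore carry all fibre operations to the same
   operation on A. For the final isomorphism any family of arrows zeta -> l will
   do: labelling the fibres through it, [l || a] becomes the arrow from l with
   label a, and \bu_l is read off from the groupoid product. *)
Require Import Defs.
From HB Require Import structures.
From mathcomp Require Import all_boot.
From mathcomp Require Import boolp classical_sets functions.

Set Implicit Arguments.
Unset Strict Implicit.
Unset Printing Implicit Defensive.

Local Open Scope classical_set_scope.

(** * A group on a subset as a bundled group type *)

Section GroupOnCarrier.
Variables (T : Type) (D : set T) (op : T -> T -> T) (e : T) (inv : T -> T).
Hypothesis gD : group_on D op e inv.

(** The proof of the axioms is an argument of the type, so that the canonical group structure can be
    recovered from the type alone. *)
Definition group_on_carrier of group_on D op e inv : Type := {x : T | D x}.
Local Notation carrier := (group_on_carrier gD).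

HB.instance Definition _ := gen_eqMixin carrier.
HB.instance Definition _ := gen_choiceMixin carrier.

Lemma group_on_carrier_eq (u v : carrier) : sval u = sval v -> u = v.
Proof. by case: u v => [x Dx] [y Dy] /= E; exact: eq_exist. Qed.

Definition group_on_mul (u v : carrier) : carrier :=
  exist _ (op (sval u) (sval v)) (grp_op gD (svalP u) (svalP v)).
Definition group_on_one : carrier := exist _ e (grp_e gD).
Definition group_on_inv (u : carrier) : carrier :=
  exist _ (inv (sval u)) (grp_inv gD (svalP u)).

Fact group_on_mulA : associative group_on_mul.
Proof.
by move=> u v w; apply/group_on_carrier_eq/(grpA gD) => //; exact: svalP.
Qed.

Fact group_on_mul1 : left_id group_on_one group_on_mul.
Proof. by move=> u; apply/group_on_carrier_eq/(grp1x gD)/svalP. Qed.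

Fact group_on_mulr1 : right_id group_on_one group_on_mul.
Proof. by move=> u; apply/group_on_carrier_eq/(grpx1 gD)/svalP. Qed.

Fact group_on_mulV : left_inverse group_on_one group_on_inv group_on_mul.
Proof. by move=> u; apply/group_on_carrier_eq/(grpVx gD)/svalP. Qed.

Fact group_on_mulrV : right_inverse group_on_one group_on_inv group_on_mul.
Proof. by move=> u; apply/group_on_carrier_eq/(grpxV gD)/svalP. Qed.

HB.instance Definition _ := isGroup.Build carrier group_on_mulA group_on_mul1
  group_on_mulr1 group_on_mulV group_on_mulrV.

(** Hides the subtype: later sections see a fibre group only through the total maps [f] and [g]. *)
Lemma group_on_groupType : exists (A : groupType) (f : T -> A) (g : A -> T),
  [/\ forall a, D (g a), cancel g f, forall x, D x -> g (f x) = x &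
      forall x y, D x -> D y -> f (op x y) = (f x * f y)%g].
Proof.
(* The value 1 outside [D] is a dummy that makes [f] total. *)
pose f x : carrier := if pselect (D x) is left Dx then exist _ x Dx else 1%g.
have fE x : D x -> sval (f x) = x by rewrite /f; case: pselect.
exists carrier, f, sval; split=> [a|u|x Dx|x y Dx Dy].
- exact: svalP.
- exact/group_on_carrier_eq/fE/svalP.
- exact: fE.
- apply/group_on_carrier_eq; rewrite /= !fE //; exact: grp_op gD _ _ Dx Dy.
Qed.

End GroupOnCarrier.

(** * Maximal wide thin subgroupoids of a connected groupoid *)

Section WideThin.
Variables (L : Type) (G : groupoid L).
Implicit Types (l m : L) (x : G) (S : set G).

(** Meant for a star of arrows [y l] from a fixed vertex to [l]: its members are then the detours
    through the centre, one for each pair of vertices. *)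
Definition star_subgroupoid (y : L -> G) : set G :=
  [set x | x = ginv (y (src x)) \bu y (tgt x)].

Section Star.
Variables (zeta : L) (y : L -> G).
Hypotheses (src_y : forall l, src (y l) = zeta)
  (tgt_y : forall l, tgt (y l) = l).

Lemma star_subgroupoid_arrow l m :
  star_subgroupoid y (ginv (y l) \bu y m) /\
  src (ginv (y l) \bu y m) = l /\ tgt (ginv (y l) \bu y m) = m.
Proof.
have c : tgt (ginv (y l)) = src (y m) by rewrite tgt_ginv !src_y.
by rewrite /star_subgroupoid /= src_gmul // tgt_gmul // src_ginv !tgt_y.
Qed.

Lemma star_subgroupoid_wide_thin : wide_thin_subgroupoid (star_subgroupoid y).
Proof.
have c l m : tgt (ginv (y l)) = src (y m) by rewrite tgt_ginv !src_y.
split; rewrite /star_subgroupoid /=.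
- split=> [u v Su Sv uv|u Su] /=.
    rewrite src_gmul // tgt_gmul // {1}Su {1}Sv -gmulA //; last first.
      by rewrite tgt_y src_gmul // src_ginv tgt_y.
    by rewrite uv gmulVK // !src_y.
  by rewrite src_ginv tgt_ginv {1}Su ginvM // ginvK.
- by move=> l; rewrite src_gunit tgt_gunit gmulVx tgt_y.
- by move=> u v Su Sv su tv; rewrite Su Sv su tv.
Qed.

End Star.

(** An arrow of a larger thin [T] is parallel to an arrow of [S], hence equal to it. *)
Lemma connected_wide_thin_maximal S : wide_thin_subgroupoid S ->
  (forall l m, exists x, S x /\ src x = l /\ tgt x = m) -> maximal_wide_thin S.
Proof.
move=> tS cS; split=> // T [_ _ thinT] ST; apply/seteqP; split=> // u Tu.
have [v [Sv [sv tv]]] := cS (src u) (tgt u).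
by rewrite (thinT u v) //; exact: ST.
Qed.

Lemma maximal_wide_thin_exists (zeta : L) :
  connected G -> exists S, maximal_wide_thin S.
Proof.
move=> hG; have [y yP] := choice (hG zeta).
have sy l := proj1 (yP l); have ty l := proj2 (yP l).
exists (star_subgroupoid y); apply: connected_wide_thin_maximal.
  exact: star_subgroupoid_wide_thin sy ty.
by move=> l m; exists (ginv (y l) \bu y m);
  exact: star_subgroupoid_arrow sy ty l m.
Qed.

(* Joining zeta to one representative of each component of S gives a connected
   wide thin subgroupoid containing S. *)
Lemma maximal_wide_thin_connected S : connected G -> maximal_wide_thin S ->
  forall l m, exists x, S x /\ src x = l /\ tgt x = m.
Proof.
move=> hG [[[SM SV] S1 thinS] maxS] zeta.
have [k kP] := choice (hG zeta).
have sk l := proj1 (kP l); have tk l := proj2 (kP l).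
pose E l m := exists x, S x /\ src x = l /\ tgt x = m.
have Ell l : E l l by exists (gunit G l); rewrite src_gunit tgt_gunit.
(* Components are equal as predicates, so a representative chosen from the predicate depends only on
   the component. *)
have EE l m : E l m -> E l = E m.
  move=> [u [Su [su tu]]]; apply/funext => n; apply/propext; split.
    move=> [v [Sv [sv tv]]]; exists (ginv u \bu v).
    have c : tgt (ginv u) = src v by rewrite tgt_ginv su.
    split; first by apply: SM => //; exact: SV.
    by rewrite src_gmul // tgt_gmul // src_ginv.
  move=> [v [Sv [sv tv]]]; exists (u \bu v).
  have c : tgt u = src v by rewrite tu.
  by split; [exact: SM|rewrite src_gmul // tgt_gmul].
(* The vertex [zeta] is the default for an empty predicate. *)
have r_ex (P : L -> Prop) : exists m, (exists m, P m) -> P m.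
  by case: (pselect (exists m, P m)) => [[m Pm]|nP]; [exists m|exists zeta].
have [r rP] := choice r_ex.
have [t tP] := choice (fun l => rP (E l) (ex_intro _ l (Ell l))).
have St l := proj1 (tP l); have sr l := proj1 (proj2 (tP l)).
have tr l := proj2 (proj2 (tP l)).
(* From [zeta] to the representative of the component of [l], then to [l] inside [S]. *)
pose y l := k (r (E l)) \bu ginv (t l).
have c l : tgt (k (r (E l))) = src (ginv (t l)) by rewrite tk src_ginv tr.
have sy l : src (y l) = zeta by rewrite src_gmul.
have ty l : tgt (y l) = l by rewrite tgt_gmul // tgt_ginv.
have <- : star_subgroupoid y = S.
  apply: maxS; first exact: star_subgroupoid_wide_thin sy ty.
  move=> u Su.
  have Er : E (tgt u) = E (src u) by symmetry; apply: EE; exists u.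
  have c1 : tgt (t (src u)) = src (ginv (t (tgt u))).
    by rewrite src_ginv !tr Er.
  (* Both ends of [u] lie in one component, so the two factors [k] cancel; what remains is an arrow
     of [S] parallel to [u]. *)
  have -> : star_subgroupoid y u = (u = t (src u) \bu ginv (t (tgt u))).
    rewrite /star_subgroupoid /= /y ginvM // ginvK -gmulA; last 2 first.
    + by rewrite src_ginv tk tr.
    + by rewrite tgt_ginv src_gmul // !sk.
    by rewrite Er gmulK // tk src_ginv tr Er.
  apply: thinS => //.
  - by apply: SM => //; exact: SV.
  - by rewrite src_gmul.
  - by rewrite tgt_gmul // tgt_ginv.
by move=> m; exists (ginv (y zeta) \bu y m);
  exact: star_subgroupoid_arrow sy ty zeta m.
Qed.

End WideThin.

(** * A braiding recovered from its skew bracoid *)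

Section BraidingTheory.
Variables (L : Type) (G : groupoid L) (s : braiding G).
Implicit Types x y z : G.
Local Notation B := (bracoid_of_braiding s).

(** Multiplying either side by [x] on the left in the fibre group gives [x \bu y]. *)
Lemma lact_slact x y : tgt x = src y -> lact s x y = slact B x y.
Proof.
move=> xy; apply: (@grp_mulI _ _ _ _ _ (sdot_group B (src x)) x) => //.
- exact: src_lact.
- exact: (src_slact B xy).
- by rewrite [RHS](sdot_slact B xy) /= /bdot lactK.
Qed.

Lemma ract_sract x y : tgt x = src y -> ract s x y = sract B x y.
Proof.
move=> xy; rewrite /sract -lact_slact // -(braid_comm s xy) gmulK //.
exact: tgt_lact.
Qed.

(** The additivity [slactD] of the bracoid action, carried over to the braiding by [lact_slact];
    this is what makes transported labellings compatible. *)
Lemma lact_bdot l m x y z : src x = l -> tgt x = m -> src y = m -> src z = m ->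
  lact s x (bdot s m y z) = bdot s l (lact s x y) (lact s x z).
Proof.
move=> <- <- ym zm; rewrite lact_slact; last by rewrite src_bdot // ym.
by rewrite (slactD B) // -!lact_slact.
Qed.

End BraidingTheory.

(** * Morphisms of skew bracoids respect the braidings *)

Section BracoidMorphism.
Variables (L : Type) (G H : groupoid L) (B : skew_bracoid G)
  (C : skew_bracoid H).
Variable f : G -> H.
Hypothesis hf : bracoid_morphism B C f.

Lemma groupoid_morphismV x : f (ginv x) = ginv (f x).
Proof.
have [[sf tf f1 fM] _] := hf.
have c : tgt x = src (ginv x) by rewrite src_ginv.
by apply: ginv_uniq; rewrite ?sf ?tf -?fM // gmulxV f1.
Qed.

(** The arrow [slact x y] is determined by its fibre product with [x] being [x \bu y], and [f]
    preserves both products. *)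
Lemma bracoid_morphism_slact x y :
  tgt x = src y -> f (slact B x y) = slact C (f x) (f y).
Proof.
have [[sf tf f1 fM] fD] := hf => xy.
have c : tgt (f x) = src (f y) by rewrite tf sf.
apply: (@grp_mulI _ _ _ _ _ (sdot_group C (src x)) (f x)).
- exact: sf.
- by rewrite /arrows_from /= sf src_slact.
- by rewrite /arrows_from /= src_slact.
- by rewrite -fD ?src_slact // sdot_slact // -{1}(sf x) sdot_slact // fM.
Qed.

Lemma bracoid_morphism_sract x y :
  tgt x = src y -> f (sract B x y) = sract C (f x) (f y).
Proof.
have [[sf tf f1 fM] _] := hf => xy.
rewrite /sract fM ?groupoid_morphismV ?bracoid_morphism_slact ?fM //.
by rewrite tgt_ginv src_slact // src_gmul.
Qed.

End BracoidMorphism.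

(** On composable pairs [s] agrees with the braiding rebuilt from its bracoid, and both the map and
    its inverse preserve rebuilt braidings. *)
Lemma bracoid_isomorphism_braided (L : Type) (G H : groupoid L)
    (s : braiding G) (C : skew_bracoid H) (f : G -> H) :
  bracoid_isomorphism (bracoid_of_braiding s) C f ->
  braided_isomorphism s (braiding_of_bracoid C) f.
Proof.
move=> [hf [g [hg fK gK]]]; split.
  split=> [|x y xy]; first by case: hf.
  rewrite lact_slact // ract_sract //.
  by rewrite (bracoid_morphism_slact hf) // (bracoid_morphism_sract hf).
exists g; split=> //; split=> [|x y xy]; first by case: hg.
have [sg tg _ _] := proj1 hg.
have c : tgt (g x) = src (g y) by rewrite tg sg.
rewrite (lact_slact s c) (ract_sract s c).
by split; [apply: (bracoid_morphism_slact hg)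
            |apply: (bracoid_morphism_sract hg)].
Qed.

(** * Labellings transported from one fibre to all others *)

Section TransportedLabelling.
Variables (L : Type) (G : groupoid L) (s : braiding G) (zeta : L).
Variables (A : Type) (phi_zeta : G -> A).
Hypothesis phi_zeta_bij : set_bij (arrows_from G zeta) [set: A] phi_zeta.

Section OneVertex.
Variables (l : L) (x : G).
Hypotheses (src_x : src x = zeta) (tgt_x : tgt x = l).

(** Solves the defining condition by taking [u] to be [lact s x v]; uniqueness on the fibre follows
    at once. *)
Lemma transported_labellingE (phi_l : G -> A) :
  transported_labelling s zeta phi_zeta x l phi_l ->
  forall v, src v = l -> phi_l v = phi_zeta (lact s x v).
Proof.
move=> [_ E] v vl; rewrite -E; first by rewrite lactK // tgt_x.
by rewrite src_lact ?tgt_x.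
Qed.

(** Acting by [x] is a bijection from the fibre over [l] to the one over [zeta], inverted by acting
    with [ginv x]. *)
Lemma transported_labelling_exists :
  transported_labelling s zeta phi_zeta x l (fun v => phi_zeta (lact s x v)).
Proof.
case: phi_zeta_bij => _ inj surj.
split=> [|u uz]; last by rewrite lactVK // src_x.
split=> // [u v /set_mem /= ul /set_mem /= vl E|a _].
  have lz w : src w = l -> lact s x w \in arrows_from G zeta.
    by move=> wl; apply/mem_set; rewrite /arrows_from /= src_lact // tgt_x.
  have /(congr1 (lact s (ginv x))) := inj _ _ (lz _ ul) (lz _ vl) E.
  by rewrite !lactK // tgt_x.
have [u] := surj a I; rewrite /arrows_from /= => uz <-.
exists (lact s (ginv x) u).
  by rewrite /arrows_from /= src_lactV // src_x.
by rewrite /= lactVK // src_x.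
Qed.

End OneVertex.

(** The right-hand side does not mention [l], which gives the independence of the vertex. *)
Lemma transported_labelling_op (x : L -> G) (phi : L -> G -> A) l a b :
  src (x l) = zeta -> tgt (x l) = l ->
  transported_labelling s zeta phi_zeta (x l) l (phi l) ->
  let phiV := 'pinv_(fun=> gunit G zeta) (arrows_from G zeta) phi_zeta in
  labelled_op (bracoid_of_braiding s) phi l a b =
  phi_zeta (bdot s zeta (phiV a) (phiV b)).
Proof.
move=> sx tx tl phiV; have [phi_bij _] := tl.
have E := transported_labellingE sx tx tl.
have [_ _ surj] := phi_bij; have [_ inj surjz] := phi_zeta_bij.
rewrite /labelled_op /=; set psi := 'pinv_ _ _ (phi l).
(* Surjectivity on the fibre makes [psi] a true section, so the default unit in ['pinv_] is never
   reached. *)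
have psiP c : src (psi c) = l /\ phi l (psi c) = c.
  split.
    by apply: (surjpinv_image_sub (dflt := fun=> gunit G l) surj); exists c.
  by rewrite /psi (surjpK _ surj) // in_setT.
have sV c : src (phiV c) = zeta.
  by apply: (surjpinv_image_sub (dflt := fun=> gunit G zeta) surjz); exists c.
(* Both arrows start at [zeta] and have the label [c] under the injective [phi_zeta]. *)
have pV c : phiV c = lact s (x l) (psi c).
  have [pl pc] := psiP c.
  apply: inj; rewrite ?inE /arrows_from /= ?src_lact ?tx //.
  by rewrite -E // pc /phiV (surjpK _ surjz) // in_setT.
have [[al _] [bl _]] := (psiP a, psiP b).
rewrite E ?src_bdot ?al ?bl // !pV; congr phi_zeta.
exact: lact_bdot.
Qed.

Lemma transported_labelling_Matsumoto_Shimizu (x : L -> G)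
    (phi : L -> G -> A) :
  (forall l, src (x l) = zeta) -> (forall l, tgt (x l) = l) ->
  (forall l, transported_labelling s zeta phi_zeta (x l) l (phi l)) ->
  Matsumoto_Shimizu_labelling (bracoid_of_braiding s) phi.
Proof.
move=> sx tx tphi; split=> [l|l m a b]; first by case: (tphi l).
by rewrite (transported_labelling_op _ _ _ _ (tphi l))
  ?(transported_labelling_op _ _ _ _ (tphi m)).
Qed.

End TransportedLabelling.

(** * The dynamical skew brace read off from a labelling *)

Section DynSkewBraceOfBraiding.
Variables (L : Type) (G : groupoid L) (s : braiding G) (zeta : L) (x : L -> G).
Hypotheses (src_x : forall l, src (x l) = zeta)
  (tgt_x : forall l, tgt (x l) = l).
Variables (A : groupType) (f : G -> A) (g : A -> G).
Hypotheses (src_g : forall a, src (g a) = zeta) (gK : cancel g f).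
Hypothesis fK : forall u, src u = zeta -> g (f u) = u.
Hypothesis fM : forall u v, src u = zeta -> src v = zeta ->
  f (bdot s zeta u v) = (f u * f v)%g.
Implicit Types (l : L) (a b c : A) (u v : G).

(** The labelling of the fibre over [l] transported from [f] along [x l]; [labelled_arrow l] is its
    inverse on that fibre. *)
Definition label l u : A := f (lact s (x l) u).
Definition labelled_arrow l a : G := lact s (ginv (x l)) (g a).

Lemma src_labelled_arrow l a : src (labelled_arrow l a) = l.
Proof. by rewrite src_lactV ?src_x ?src_g. Qed.

Lemma labelK l u : src u = l -> labelled_arrow l (label l u) = u.
Proof.
by move=> ul; rewrite /labelled_arrow fK ?lactK ?src_lact ?tgt_x.
Qed.

Lemma labelled_arrowK l a : label l (labelled_arrow l a) = a.
Proof. by rewrite /label lactVK ?gK // src_x src_g. Qed.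

Lemma labelM l u v : src u = l -> src v = l ->
  label l (bdot s l u v) = (label l u * label l v)%g.
Proof.
move=> ul vl; rewrite /label (lact_bdot s (src_x l) (tgt_x l)) //.
by rewrite fM // src_lact ?tgt_x.
Qed.

Lemma label1 l : label l (gunit G l) = 1%g.
Proof.
have sl := src_gunit G l.
have := labelM sl sl; rewrite (grp1x (bdot_group s l)) // -[LHS]mulg1.
by move=> /mulgI.
Qed.

Lemma labelV l u : src u = l -> label l (bdinv s l u) = (label l u)^-1%g.
Proof.
move=> ul; have vl : src (bdinv s l u) = l := grp_inv (bdot_group s l) ul.
apply: (mulgI (label l u)); rewrite -labelM // mulgV.
by rewrite (grpxV (bdot_group s l)) // label1.
Qed.

Lemma labelled_arrow1 l : labelled_arrow l 1%g = gunit G l.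
Proof. by rewrite -(label1 l) labelK // src_gunit. Qed.

Definition label_tgt l a : L := tgt (labelled_arrow l a).
Definition label_mul l a b : A :=
  label l (labelled_arrow l a \bu labelled_arrow (label_tgt l a) b).

Lemma labelled_arrow_mul l a b : labelled_arrow l (label_mul l a b) =
  labelled_arrow l a \bu labelled_arrow (label_tgt l a) b.
Proof. by rewrite labelK // src_gmul src_labelled_arrow. Qed.

(** The inverse is left multiplication by the inverse of the arrow labelled [a]. *)
Lemma label_mul_bij l a : bijective (label_mul l a).
Proof.
set m := label_tgt l a; set u := labelled_arrow l a.
have ul : src u = l by exact: src_labelled_arrow.
have c b : tgt u = src (labelled_arrow m b) by rewrite src_labelled_arrow.
have d b : tgt (ginv u) = src (labelled_arrow l b).
  by rewrite tgt_ginv src_labelled_arrow.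
exists (fun b => label m (ginv u \bu labelled_arrow l b)) => b.
  by rewrite labelled_arrow_mul gmulK // labelled_arrowK.
have e : src (ginv u \bu labelled_arrow l b) = m.
  by rewrite src_gmul // src_ginv.
by rewrite /label_mul labelK // gmulVK ?labelled_arrowK // !src_labelled_arrow.
Qed.

Lemma label_tgtM l a b : label_tgt l (label_mul l a b) =
  label_tgt (label_tgt l a) b.
Proof.
by rewrite /label_tgt labelled_arrow_mul tgt_gmul // src_labelled_arrow.
Qed.

Lemma label_mulA l a b c : label_mul l a (label_mul (label_tgt l a) b c) =
  label_mul l (label_mul l a b) c.
Proof.
rewrite [LHS]/label_mul [RHS]/label_mul !labelled_arrow_mul label_tgtM.
by rewrite gmulA // src_labelled_arrow.
Qed.

(** The skew bracoid axiom seen through labels: it relates the fibres over [l] and [label_tgt l a],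
    and [labelM] turns both group operations into that of [A]. *)
Lemma label_mulD l a b c : label_mul l a (b * c)%g =
  (label_mul l a b * a^-1 * label_mul l a c)%g.
Proof.
have sa d : src (labelled_arrow (label_tgt l a) d) = label_tgt l a.
  exact: src_labelled_arrow.
have al := src_labelled_arrow l a.
have sm d : src (labelled_arrow l a \bu labelled_arrow (label_tgt l a) d) = l.
  by rewrite src_gmul.
(* The inverse labelling is multiplicative because [label] is. *)
have bcE : labelled_arrow (label_tgt l a) (b * c)%g =
    bdot s (label_tgt l a) (labelled_arrow (label_tgt l a) b)
      (labelled_arrow (label_tgt l a) c).
  rewrite -[RHS](labelK (l := label_tgt l a)); last by rewrite src_bdot ?sa.
  by rewrite labelM // !labelled_arrowK.
rewrite /label_mul bcE.
rewrite (gmul_bdot s (x := labelled_arrow l a)) ?src_labelled_arrow //.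
have vl : src (bdinv s l (labelled_arrow l a)) = l :=
  grp_inv (bdot_group s l) al.
rewrite labelM ?labelM ?labelV ?labelled_arrowK //.
by rewrite src_bdot ?sm.
Qed.

Lemma label_tgt1 l : label_tgt l 1%g = l.
Proof. by rewrite /label_tgt labelled_arrow1 tgt_gunit. Qed.

Definition dsb_of_braiding : dyn_skew_brace L A :=
  DynSkewBrace label_mul_bij label_mulA label_mulD label_tgtM
    (fun l _ => label_tgt1 l).

Lemma dsb_of_braiding_zero_symmetric : zero_symmetric dsb_of_braiding.
Proof.
move=> l b; rewrite /= /label_mul label_tgt1 labelled_arrow1.
have := gmul1x (labelled_arrow l b); rewrite src_labelled_arrow => ->.
exact: labelled_arrowK.
Qed.

(** An arrow is recovered from its source and its label, and the brace operations were defined so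
    that this correspondence preserves products. *)
Lemma dsb_of_braiding_isomorphism (hL : inhabited L)
    (hB : zero_symmetric dsb_of_braiding) :
  bracoid_isomorphism (bracoid_of_braiding s) (dsb_bracoid hL hB)
    (fun u => (src u, label (src u) u) : dsb_groupoid hL hB).
Proof.
split.
  split; last first.
    by move=> l u v ul vl; rewrite /= /dsb_dot /= src_bdot ?ul ?vl // labelM.
  split=> //= [u|l|u v uv].
  - by rewrite /label_tgt labelK.
  - by rewrite src_gunit label1.
  - rewrite /dsb_gmul /= src_gmul // /label_mul /label_tgt.
    by rewrite labelK // uv labelK.
exists (fun p => labelled_arrow p.1 p.2); split=> [|u|[l a]] /=.
- split.
    split=> //= [p|l|p q pq]; first exact: src_labelled_arrow.
      exact: labelled_arrow1.
    by rewrite labelled_arrow_mul /label_tgt -[in RHS]pq.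
  move=> l [k a] [m b] /= -> ->.
  rewrite -[RHS](labelK (l := l)) ?src_bdot ?src_labelled_arrow //.
  by rewrite labelM ?labelled_arrowK ?src_labelled_arrow.
- exact: labelK.
- by rewrite src_labelled_arrow labelled_arrowK.
Qed.

End DynSkewBraceOfBraiding.

(** * Subgroupoids, labellings and the isomorphism combined *)

Theorem theorem5p9 (L : Type) (hL : inhabited L) (G : groupoid L)
    (hG : connected G) (s : braiding G) :
  [/\ exists S : set G, maximal_wide_thin S,
      forall S : set G, maximal_wide_thin S ->
        (forall l m, exists! x, S x /\ src x = l /\ tgt x = m) /\
        forall (zeta : L) (A : Type) (phi_zeta : G -> A),
        set_bij (arrows_from G zeta) [set: A] phi_zeta ->
        forall x : L -> G,
        (forall l, S (x l) /\ src (x l) = zeta /\ tgt (x l) = l) ->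
        [/\ forall l, exists phi_l,
              transported_labelling s zeta phi_zeta (x l) l phi_l,
            forall l phi_l psi_l,
              transported_labelling s zeta phi_zeta (x l) l phi_l ->
              transported_labelling s zeta phi_zeta (x l) l psi_l ->
              {in arrows_from G l, phi_l =1 psi_l} &
            forall phi : L -> G -> A,
              (forall l,
                 transported_labelling s zeta phi_zeta (x l) l (phi l)) ->
              Matsumoto_Shimizu_labelling (bracoid_of_braiding s) phi] &
      exists (A : groupType) (B : dyn_skew_brace L A)
             (hB : zero_symmetric B) (f : G -> dsb_groupoid hL hB),
        braided_isomorphism s (dsb_braiding hL hB) f /\
        bracoid_isomorphism (bracoid_of_braiding s) (dsb_bracoid hL hB) f].
Proof.
have [zeta] := hL; split.
- exact: maximal_wide_thin_exists hG.
- move=> S maxS; have cS := maximal_wide_thin_connected hG maxS.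
  have [[_ _ thinS] _] := maxS.
  split=> [l m|z A phi_z phi_bij x xP].
    have [u [Su [su tu]]] := cS l m; exists u; split=> // v [Sv [sv tv]].
    by apply: thinS; rewrite ?su ?tu.
  have sx l := proj1 (proj2 (xP l)); have tx l := proj2 (proj2 (xP l)).
  split=> [l|l phi psi tphi tpsi v /set_mem /= vl|phi tphi].
  + by eexists; exact: transported_labelling_exists.
  + by rewrite (transported_labellingE (sx l) (tx l) tphi) //
      (transported_labellingE (sx l) (tx l) tpsi).
  + exact: transported_labelling_Matsumoto_Shimizu tphi.
(* Any arrows from [zeta] serve here; the group [A] is the fibre over [zeta]. *)
- have [x xP] := choice (hG zeta).
  have sx l := proj1 (xP l); have tx l := proj2 (xP l).
  have [A [f [g [sg gK fK fM]]]] := group_on_groupType (bdot_group s zeta).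
  have hB := dsb_of_braiding_zero_symmetric sx tx sg gK fK fM.
  have iso := dsb_of_braiding_isomorphism hL hB.
  (* The bracoid isomorphism fixes the map, and the same map is then shown to be braided. *)
  exists A, _, hB; eexists; split; last exact: iso.
  exact: bracoid_isomorphism_braided iso.
Qed.
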